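(* Let $z_0\in\mathbb{C}\setminus\{0\}$, $\lambda>0$, and let $Z$ be the complex valued Ornstein–Uhlenbeck process $Z_t=z_0+\tilde{Z}_t-\lambda\int_0^t Z_s\,ds$, where $\tilde Z$ is a complex Brownian motion starting from $0$. Let $\alpha_t=\int_0^t e^{2\lambda s}ds=\frac{e^{2\lambda t}-1}{2\lambda}$ and let $\mathbb{B}$ be the complex Brownian motion starting from $z_0$ such that $Z_t=e^{-\lambda t}\,\mathbb{B}_{\alpha_t}$ for all $t\ge0$. Let $\theta^{Z}$ and $\theta^{\mathbb{B}}$ be the continuous winding processes of $Z$ and $\mathbb{B}$ around $0$. Then, for all $t\ge0$, $$\theta^{Z}_{t}=\theta^{\mathbb{B}}_{\alpha_{t}},$$ and, for every $c>0$, with $T^{(\lambda)}_{c}=\inf\{t\geq0:|\theta^{Z}_{t}|=c\}$ and $T^{\theta^{\mathbb{B}}}_{-c,c}=\inf\{t\ge0:\theta^{\mathbb{B}}_t\notin(-c,c)\}$, $$T^{(\lambda)}_{c}=\frac{1}{2\lambda}\ln\left(1+2\lambda\,T^{\theta^{\mathbb{B}}}_{-c,c}\right).$$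
   Context: The continuous winding process around $0$ of a continuous semimartingale $W$ in $\mathbb{C}\setminus\{0\}$ is $\theta^{W}_t=\mathrm{Im}\left(\int_0^t\frac{dW_s}{W_s}\right)$ (so $\theta^W_0=0$). The representation $Z_t=e^{-\lambda t}\left(z_0+\int_0^t e^{\lambda s}d\tilde Z_s\right)=e^{-\lambda t}\,\mathbb{B}_{\alpha_t}$ with $\mathbb{B}$ a complex Brownian motion starting from $z_0$ comes from the Dambis–Dubins–Schwarz theorem. *)

(* Defs.v *)
From HB Require Import structures.
From mathcomp Require Import all_boot all_order all_algebra.
From mathcomp Require Import complex.
From mathcomp Require Import all_classical all_reals all_analysis.

Set Implicit Arguments.
Unset Strict Implicit.
Unset Printing Implicit Defensive.

Import Order.TTheory GRing.Theory Num.Theory.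
Import numFieldNormedType.Exports.

Local Open Scope classical_set_scope.
Local Open Scope ring_scope.
Local Open Scope complex_scope.

(* Processes are functions [R -> T -> _]; only their values at times t >= 0
   matter. *)
Section processes.
Context {R : realType} {d : measure_display} {T : measurableType d}.
Variable P : probability T R.
Implicit Types (X : R -> T -> R) (W H : R -> T -> R[i]).

Definition ReP W : R -> T -> R := fun t w => complex.Re (W t w).
Definition ImP W : R -> T -> R := fun t w => complex.Im (W t w).

Definition ae_continuous X : Prop :=
  \forall w \ae P, {within `[0, +oo[, continuous (fun t => X t w)}.

Definition generated_by (D : set R) X : set (set T) :=
  <<s \bigcup_(u in D) preimage_set_system setT (X u) measurable >>.

Definition independent_systems (F G : set (set T)) : Prop :=
  forall A B, F A -> G B -> P (A `&` B) = (P A * P B)%E.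

(* [normal_prob m s] takes the standard deviation s. *)
Record brownian_motion (x : R) X : Prop := BrownianMotion {
  bm_measurable : forall t, 0 <= t -> measurable_fun setT (X t) ;
  bm_start : \forall w \ae P, X 0 w = x ;
  bm_indep : forall s t, 0 <= s -> s <= t ->
    independent_systems (generated_by `[0, s] X)
      (preimage_set_system setT (fun w => X t w - X s w) measurable) ;
  bm_gauss : forall s t, 0 <= s -> s < t ->
    forall A : set R, measurable A ->
      P ((fun w => X t w - X s w) @^-1` A)
        = normal_prob 0 (Num.sqrt (t - s)) A ;
  bm_continuous : ae_continuous X }.

Record complex_brownian_motion (z : R[i]) W : Prop := ComplexBrownianMotion {
  cbm_Re : brownian_motion (complex.Re z) (ReP W) ;
  cbm_Im : brownian_motion (complex.Im z) (ImP W) ;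
  cbm_indep : independent_systems (generated_by `[0, +oo[ (ReP W))
                                  (generated_by `[0, +oo[ (ImP W)) }.

Definition complex_Rintegral (D : set R) (f : R -> R[i]) : R[i] :=
  Complex (\int[lebesgue_measure]_(s in D) complex.Re (f s))
          (\int[lebesgue_measure]_(s in D) complex.Im (f s)).

Record continuous_process W : Prop := ContinuousProcess {
  cp_Re_measurable : forall t, 0 <= t -> measurable_fun setT (ReP W t) ;
  cp_Im_measurable : forall t, 0 <= t -> measurable_fun setT (ImP W t) ;
  cp_Re_continuous : ae_continuous (ReP W) ;
  cp_Im_continuous : ae_continuous (ImP W) }.

Record ornstein_uhlenbeck (z0 : R[i]) (lambda : R) (Zt Z : R -> T -> R[i])
    : Prop := OrnsteinUhlenbeck {
  ou_process : continuous_process Z ;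
  ou_equation : \forall w \ae P, forall t, 0 <= t ->
    Z t w = z0 + Zt t w
            - lambda%:C * complex_Rintegral `[0, t] (fun s => Z s w) }.

Definition natural_filtration W (t : R) : set (set T) :=
  <<s generated_by `[0, t] (ReP W) `|` generated_by `[0, t] (ImP W) >>.

(* [SimpleProcess n a h0 h] stands for the process
   h0 1_{0} + \sum_(i < n) h i 1_]a i, a i.+1]. *)
Record simple_process := SimpleProcess {
  sp_size : nat ;
  sp_time : nat -> R ;
  sp_coef0 : T -> R[i] ;
  sp_coef : nat -> T -> R[i] }.

Definition sp_val (S : simple_process) (t : R) (w : T) : R[i] :=
  (if t == 0 then sp_coef0 S w else 0)
  + \sum_(i < sp_size S)
      (if t \in `]sp_time S i, sp_time S i.+1] then sp_coef S i w else 0).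

(* The integral over ]0, t]: the value at time 0 does not contribute. *)
Definition sp_integral (S : simple_process) W (t : R) (w : T) : R[i] :=
  \sum_(i < sp_size S)
    sp_coef S i w * (W (Num.min (sp_time S i.+1) t) w
                     - W (Num.min (sp_time S i) t) w).

Definition sigma_measurable (F : set (set T)) (h : T -> R[i]) : Prop :=
  forall A : set R, measurable A ->
    F ((fun w => complex.Re (h w)) @^-1` A) /\
    F ((fun w => complex.Im (h w)) @^-1` A).

Record simple_predictable (F : R -> set (set T)) (S : simple_process)
    : Prop := SimplePredictable {
  sp_time_ge0 : 0 <= sp_time S 0%N ;
  sp_time_nd : forall i, sp_time S i <= sp_time S i.+1 ;
  sp_coef0_meas : sigma_measurable (F 0) (sp_coef0 S) ;
  sp_coef_meas : forall i, (i < sp_size S)%N ->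
    sigma_measurable (F (sp_time S i)) (sp_coef S i) }.

(* Convergence in probability, uniformly on compact time intervals. The outer
   measure [mu_ext P] agrees with P on measurable sets; it is needed because
   the event below is an uncountable union. *)
Definition ucp_cvg (W_ : nat -> R -> T -> R[i]) W : Prop :=
  forall t e : R, 0 <= t -> 0 < e ->
    mu_ext P [set w | exists2 s, s \in `[0, t] &
                        e < Normc.normc (W_ n s w - W s w)]
      @[n --> \oo] --> 0%E.

(* I is the Ito integral of the (left-continuous adapted) process H against
   the semimartingale W for the filtration F: the ucp-continuous extension of
   the elementary integral of simple predictable processes. The product in
   [sp_integral] is the complex one, so this is the complex integral. *)
Definition stochastic_integral (F : R -> set (set T)) H W
    (I : R -> T -> R[i]) : Prop :=
  forall S_ : nat -> simple_process,
    (forall n, simple_predictable F (S_ n)) ->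
    ucp_cvg (fun n => sp_val (S_ n)) H ->
    ucp_cvg (fun n => sp_integral (S_ n) W) I.

(* theta = Im (\int dW / W), in a version with continuous paths. The integral
   does not depend on the filtration for which W is a semimartingale; the
   smallest one is used. *)
Record winding_process W (theta : R -> T -> R) : Prop := WindingProcess {
  wp_process : continuous_process W ;
  wp_neq0 : \forall w \ae P, forall t, 0 <= t -> W t w != 0 ;
  wp_continuous : ae_continuous theta ;
  wp_integral : exists2 I : R -> T -> R[i],
    stochastic_integral (natural_filtration W) (fun t w => (W t w)^-1) W I &
    \forall w \ae P, forall t, 0 <= t -> theta t w = complex.Im (I t w) }.

End processes.

Definition alpha {R : realType} (lambda t : R) : R :=
  \int[lebesgue_measure]_(s in `[0, t]) expR (2 * lambda * s).

Lemma alphaE {R : realType} (lambda t : R) : 0 < lambda -> 0 <= t ->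
  alpha lambda t = (expR (2 * lambda * t) - 1) / (2 * lambda).
Proof.
move=> l0; have l2 : 2 * lambda != 0 by rewrite mulf_neq0// gt_eqF.
rewrite le_eqVlt => /predU1P[<-|t0].
  by rewrite /alpha set_itv1 Rintegral_set1 mulr0 expR0 subrr mul0r.
pose F s := (2 * lambda)^-1 * expR (2 * lambda * s).
have dF (x : R) : is_derive x 1 F (expR (2 * lambda * x)).
  have dl : is_derive x (1 : R) ( *%R (2 * lambda)) (2 * lambda).
    by apply: is_derive_eq; rewrite scaler1.
  have := is_deriveZ (2 * lambda)^-1 (is_derive1_comp (is_derive_expR _) dl).
  by move=> h; apply: is_derive_eq; rewrite /GRing.scale/= mulrCA mulVf// mulr1.
have cF : continuous F.
  by move=> x; apply/differentiable_continuous/derivable1_diffP; case: (dF x).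
rewrite /alpha /Rintegral (@continuous_FTC2 _ _ F)//=.
- by rewrite /F mulr0 expR0 mulr1 mulrBl mul1r mulrC.
- apply: continuous_subspaceT => x.
  apply: (@continuous_comp _ _ _ ( *%R (2 * lambda)) expR).
    exact: mulrl_continuous.
  exact: continuous_expR.
- split.
  + by move=> x _; case: (dF x).
  + by apply: cvg_at_right_filter; exact: cF.
  + by apply: cvg_at_left_filter; exact: cF.
- by move=> x _; rewrite derive1E; case: (dF x).
Qed.

(* Both times are +oo when the event never occurs. *)
Definition hitting_time {R : realType} (x : R -> R) (c : R) : \bar R :=
  ereal_inf [set t%:E | t in [set t | 0 <= t /\ `|x t| = c]].

Definition exit_time {R : realType} (x : R -> R) (c : R) : \bar R :=
  ereal_inf [set t%:E | t in [set t | 0 <= t /\ x t \notin `]- c, c[ ]].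

(* Main.v *)
(* Both windings are limits, uniformly on compacts in probability, of the
   Riemann sums Im \sum_i (W_{t_i})^-1 (W_{t_{i+1}} - W_{t_i}): along the grid
   t_i = i / (n + 1) for Z and along alpha t_i for B.  With b = B \o alpha,
   Z_v / Z_u is b_v / b_u times the real number e^{- lambda (v - u)}, so the two
   i-th terms differ by
   (e^{- lambda (t_{i+1} - t_i)} - 1) Im (b_{t_{i+1}} / b_{t_i}).
   The sums up to t thus differ by at most lambda t sup |Im (b_v / b_u)| over
   |u - v| <= 1 / (n + 1), which vanishes in the limit by uniform continuity of
   the paths: no Ito formula or time-change theorem is needed.  The hitting time
   identity then follows from the intermediate value theorem and from the
   explicit inverse of alpha. *)
Require Import Defs.
From mathcomp Require Import all_boot all_order all_algebra.
From mathcomp Require Import complex.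
From mathcomp Require Import all_classical all_reals all_analysis.
From mathcomp Require Import measurable_realfun ring lra.
Import Order.TTheory GRing.Theory Num.Theory.
Import numFieldNormedType.Exports.
Local Open Scope classical_set_scope.
Local Open Scope ring_scope.
Local Open Scope complex_scope.
Set Implicit Arguments.
Unset Strict Implicit.
Unset Printing Implicit Defensive.

(** * Complex-valued functions through their real and imaginary parts *)

Section complex_valued_functions.
Variable R : realType.
Implicit Types (x y z : R[i]) (r : R).

Lemma ReM x y :
  complex.Re (x * y) = complex.Re x * complex.Re y - complex.Im x * complex.Im y.
Proof. by case: x; case: y. Qed.

Lemma ImM x y :
  complex.Im (x * y) = complex.Re x * complex.Im y + complex.Im x * complex.Re y.
Proof. by case: x; case: y. Qed.

Lemma ImD x y : complex.Im (x + y) = complex.Im x + complex.Im y.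
Proof. by case: x; case: y. Qed.

Lemma ReB x y : complex.Re (x - y) = complex.Re x - complex.Re y.
Proof. by case: x; case: y. Qed.

Lemma ImB x y : complex.Im (x - y) = complex.Im x - complex.Im y.
Proof. by case: x; case: y. Qed.

Lemma ReV x :
  complex.Re x^-1 = complex.Re x / (complex.Re x ^+ 2 + complex.Im x ^+ 2).
Proof. by case: x. Qed.

Lemma ImV x :
  complex.Im x^-1 = - (complex.Im x / (complex.Re x ^+ 2 + complex.Im x ^+ 2)).
Proof. by case: x. Qed.

Lemma ImZ r x : complex.Im (r%:C * x) = r * complex.Im x.
Proof. by rewrite ImM /= mul0r addr0. Qed.

(** Replaces the modulus by a sum of absolute values, whose measurability and continuity follow
    directly from those of the two coordinates. *)
Lemma normc_le_ReIm x : Normc.normc x <= `|complex.Re x| + `|complex.Im x|.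
Proof.
case: x => a b /=; rewrite -[leRHS]ger0_norm ?addr_ge0// -sqrtr_sqr.
apply: ler_wsqrtr; rewrite sqrrD !real_normK ?num_real//.
rewrite -subr_ge0 [leRHS](_ : _ = `|a| * `|b| *+ 2); last by ring.
by rewrite mulrn_wge0 ?mulr_ge0.
Qed.

Lemma normIm_le_normc x : `|complex.Im x| <= Normc.normc x.
Proof.
case: x => a b /=; rewrite -sqrtr_sqr; apply: ler_wsqrtr.
by rewrite lerDr sqr_ge0.
Qed.

Lemma sqrDsqr_neq0 x : x != 0 -> complex.Re x ^+ 2 + complex.Im x ^+ 2 != 0.
Proof.
apply: contra_neq => /eqP; case: x => a b /=.
by rewrite paddr_eq0 ?sqr_ge0// !sqrf_eq0 => /andP[/eqP-> /eqP->].
Qed.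

Definition cmeasurable {d} {T : measurableType d} (f : T -> R[i]) : Prop :=
  measurable_fun setT (fun w => complex.Re (f w)) /\
  measurable_fun setT (fun w => complex.Im (f w)).

Definition ccontinuous {U : topologicalType} (f : U -> R[i]) : Prop :=
  continuous (fun u => complex.Re (f u)) /\
  continuous (fun u => complex.Im (f u)).

Section measurable.
Context {d} {T : measurableType d}.
Implicit Types f g : T -> R[i].

Lemma cmeasurableB f g : cmeasurable f -> cmeasurable g ->
  cmeasurable (fun w => f w - g w).
Proof.
move=> [mRf mIf] [mRg mIg]; split.
- by under eq_fun do rewrite ReB; exact: measurable_funB.
- by under eq_fun do rewrite ImB; exact: measurable_funB.
Qed.

Lemma cmeasurableM f g : cmeasurable f -> cmeasurable g ->
  cmeasurable (fun w => f w * g w).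
Proof.
move=> [mRf mIf] [mRg mIg]; split.
- under eq_fun do rewrite ReM.
  by apply: measurable_funB; exact: measurable_funM.
- under eq_fun do rewrite ImM.
  by apply: measurable_funD; exact: measurable_funM.
Qed.

Lemma cmeasurableV f : cmeasurable f -> cmeasurable (fun w => (f w)^-1).
Proof.
move=> [mRf mIf].
have mn : measurable_fun setT
    (fun w => (complex.Re (f w) ^+ 2 + complex.Im (f w) ^+ 2)^-1).
  (* Inversion becomes a real power of exponent -1, which is measurable; the base is nonnegative,
     and at 0 both expressions are 0 by convention. *)
  under eq_fun do rewrite -powR_inv1 ?addr_ge0 ?sqr_ge0//.
  apply: (measurableT_comp (measurable_powR (-1))).
  by apply: measurable_funD; exact: measurable_funX.
split.
- by under eq_fun do rewrite ReV; exact: measurable_funM.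
- under eq_fun do rewrite ImV; apply: measurableT_comp => //.
  exact: measurable_funM.
Qed.

End measurable.

Section continuous.
Context {U : topologicalType}.
Implicit Types f g : U -> R[i].

Lemma ccontinuousB f g : ccontinuous f -> ccontinuous g ->
  ccontinuous (fun u => f u - g u).
Proof.
move=> [cRf cIf] [cRg cIg]; split => u.
- under eq_fun do rewrite ReB.
  by apply: cvgB; [exact: cRf|exact: cRg].
- under eq_fun do rewrite ImB.
  by apply: cvgB; [exact: cIf|exact: cIg].
Qed.

Lemma ccontinuousM f g : ccontinuous f -> ccontinuous g ->
  ccontinuous (fun u => f u * g u).
Proof.
move=> [cRf cIf] [cRg cIg]; split => u.
- under eq_fun do rewrite ReM.
  by apply: cvgB; apply: cvgM; [exact: cRf|exact: cRg|exact: cIf|exact: cIg].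
- under eq_fun do rewrite ImM.
  by apply: cvgD; apply: cvgM; [exact: cRf|exact: cIg|exact: cIf|exact: cRg].
Qed.

Lemma ccontinuousV f : (forall u, f u != 0) -> ccontinuous f ->
  ccontinuous (fun u => (f u)^-1).
Proof.
move=> f0 [cRf cIf].
have cn u : {for u, continuous
    (fun u => (complex.Re (f u) ^+ 2 + complex.Im (f u) ^+ 2)^-1)}.
  apply: cvgV; first exact: sqrDsqr_neq0.
  apply: cvgD; under eq_fun do rewrite expr2;
    by apply: cvgM; [exact: cRf|exact: cRf] || (apply: cvgM; exact: cIf).
split => u.
- under eq_fun do rewrite ReV.
  by apply: cvgM; [exact: cRf|exact: cn].
- under eq_fun do rewrite ImV.
  by apply: cvgN; apply: cvgM; [exact: cIf|exact: cn].
Qed.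

End continuous.

End complex_valued_functions.

(** Paths are continuous only within the half-line of nonnegative times; composing with a map that
    stays there yields continuity in the ordinary sense. *)
Lemma continuous_comp_within (R : realType) (U : topologicalType) (D : set R)
    (f : R -> R) (h : U -> R) :
  {within D, continuous f} -> continuous h -> (forall u, D (h u)) ->
  continuous (fun u => f (h u)).
Proof.
move=> /subspace_continuousP cf ch Dh u.
apply: (@cvg_comp _ _ _ h f _ (within D (nbhs (h u)))); last exact: cf.
move=> A; rewrite /within /= => /(ch u); rewrite !nbhs_simpl /=.
by apply: filterS => v; apply.
Qed.

(** * Moduli of continuity in probability *)

(** Each diagonal point has a neighbourhood where [f] is below [e], and compactness of the segment
    makes its size uniform. *)
Lemma near_diagonal_lt (R : realType) (f : R * R -> R) (a b e : R) :
  continuous f -> (forall u, f (u, u) = 0) -> 0 < e ->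
  \forall n \near \oo, forall u v, u \in `[a, b] ->
    `|u - v| < 2 * n.+1%:R^-1 -> f (u, v) < e.
Proof.
move=> cf f0 e0.
have /compact_near_coveringP/(_ nat \oo
  (fun n u => forall v, `|u - v| < 2 * n.+1%:R^-1 -> f (u, v) < e) _) :=
  @segment_compact R a b.
move=> cov; have {cov} : \forall n \near \oo, `[a, b] `<=`
    (fun u => forall v, `|u - v| < 2 * n.+1%:R^-1 -> f (u, v) < e).
  apply: cov => x _.
  have : \forall p \near (x, x), f p < e.
    by apply: (cf (x, x) [set y | y < e]); rewrite f0; exact: lt_nbhsl.
  move=> /nbhs_ballP[r /= r0 xr].
  (* With [u] within [r / 2] of [x] and [v] within [2 / (n + 1) < r / 2] of [u], both points are
     within [r] of [x]. *)
  exists (ball x (r / 2), [set n | n.+1%:R^-1 < r / 4]).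
    split => /=; first by apply: nbhsx_ballx; rewrite divr_gt0.
    have r4 : 0 < r / 4 by rewrite divr_gt0.
    exact: (near_infty_natSinv_lt (PosNum r4)).
  move=> [u n] /= [xu nr] v uv; apply: xr; split => /=.
    by apply: le_ball xu; lra.
  apply: (@ball_split _ _ u); first exact: xu.
  rewrite -ball_normE /= (lt_le_trans uv)//.
  by move: nr; move: (_^-1) => q; lra.
apply: filterS => n nP u v uab; exact: nP.
Qed.

(** * Null sets and limits for the outer probability *)

Section outer_probability.
Context {R : realType} {d : measure_display} {T : measurableType d}.
Variable P : probability T R.
Local Open Scope ereal_scope.

(** Outer measure zero provides measurable covers of probability at most [1 / (n + 1)]; their
    intersection is a measurable null set containing [A]. *)
Lemma mu_ext_negligible (A : set T) : mu_ext P A = 0 <-> P.-negligible A.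
Proof.
split=> [A0|[N [mN N0 AN]]]; last first.
  by apply/eqP; rewrite eq_le mu_ext_ge0// andbT -N0 -measurable_mu_extE// le_mu_ext.
have cover n : exists B, [/\ measurable B, A `<=` B & P B <= (n.+1%:R^-1)%:E].
  have : mu_ext P A < (n.+1%:R^-1)%:E by rewrite A0 lte_fin invr_gt0.
  move=> /ereal_inf_lt[_ [F [mF AF] <-] FN]; exists (\bigcup_k F k); split => //.
    exact: bigcupT_measurable.
  apply: le_trans (ltW FN).
  by apply: measure_sigma_subadditive => //; exact: bigcupT_measurable.
have {cover} [B /all_and3[mB AB PB]] := choice cover.
have mcap : measurable (\bigcap_n B n) by exact: bigcapT_measurable.
exists (\bigcap_n B n); split => //; last by move=> w Aw n _; exact: AB.
apply/eqP; rewrite -measure_le0; apply/lee_addgt0Pr => e e0; rewrite add0e.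
have [n _ /(_ n (leqnn n)) ne] := near_infty_natSinv_lt (PosNum e0).
apply: le_trans (le_trans (PB n) _); last by rewrite lee_fin ltW.
by apply: le_measure; rewrite ?inE//; exact: bigcap_inf.
Qed.

Lemma mu_extU_cvg0 (A B : nat -> set T) :
  mu_ext P (A n) @[n --> \oo] --> 0 -> mu_ext P (B n) @[n --> \oo] --> 0 ->
  mu_ext P (A n `|` B n) @[n --> \oo] --> 0.
Proof.
move=> A0 B0; apply: (@squeeze_cvge _ _ _ _ (cst 0) _
    (fun n => mu_ext P (A n) + mu_ext P (B n))).
- by apply: nearW => n; rewrite mu_ext_ge0//= outer_measureU2.
- exact: cvg_cst.
- by rewrite -[X in _ --> X]adde0; apply: cvgeD.
Qed.

Lemma mu_ext_cvg0_le (A B : nat -> set T) :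
  (\forall n \near \oo, A n `<=` B n) ->
  mu_ext P (B n) @[n --> \oo] --> 0 ->
  mu_ext P (A n) @[n --> \oo] --> 0.
Proof.
move=> AB B0; apply: (@squeeze_cvge _ _ _ _ (cst 0) _
    (fun n => mu_ext P (B n))) => //; last exact: cvg_cst.
by apply: filterS AB => n AB; rewrite mu_ext_ge0//= le_mu_ext.
Qed.

End outer_probability.

(* Only countably many pairs of times are needed on the right of the inclusion
   [A n `<=` N `|` M n], which makes [M n] measurable and lets continuity from
   above apply. *)
Lemma near_diagonal_cvg0 (R : realType) d (T : measurableType d)
    (P : probability T R) (F : R * R -> T -> R) (t e : R) :
  (forall p, measurable_fun setT (F p)) ->
  (\forall w \ae P, continuous (F^~ w)) ->
  (forall u w, F (u, u) w = 0) -> 0 < e ->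
  mu_ext P [set w | exists u v, [/\ u \in `[0, t],
    `|u - v| <= n.+1%:R^-1 & e < F (u, v) w]] @[n --> \oo] --> 0%E.
Proof.
move=> mF [N [mN N0 cN]] F0 e0.
have cF w : ~ N w -> continuous (F^~ w).
  by move=> Nw; apply: contrapT => ncF; apply: Nw; exact: cN.
(* The range [[-1, t + 1]] and the factor 2 leave room for replacing [u] and [v] by nearby
   rationals. *)
pose close n u v : bool := (u \in `[-1, t + 1]) && (`|u - v| < 2 * n.+1%:R^-1).
pose M n := \bigcup_(q : rat) \bigcup_(q' : rat) [set w |
  close n (ratr q) (ratr q') /\ e < F (ratr q, ratr q') w].
have mM n : measurable (M n).
  apply: bigcupT_measurable_rat => q; apply: bigcupT_measurable_rat => q'.
  have [c|nc] := boolP (close n (ratr q) (ratr q')); last first.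
    rewrite [X in measurable X](_ : _ = set0)//.
    by apply/seteqP; split => w // -[].
  rewrite [X in measurable X](_ : _ = setT `&` F (ratr q, ratr q') @^-1` `]e, +oo[).
    exact: mF.
  by apply/seteqP; split => w /=; rewrite in_itv/= andbT => -[_ ?]; split.
have PM : P (M n) @[n --> \oo] --> 0%E.
  have mcapM : measurable (\bigcap_n M n) by exact: bigcapT_measurable.
  suff <- : P (\bigcap_n M n) = 0%E.
    apply: nonincreasing_cvg_mu => //.
      by rewrite (le_lt_trans (probability_le1 _ _))// ltry.
    move=> m n mn; apply/subsetPset => w [q _ [q' _ [/andP[qt qq'] eF]]].
    exists q => //; exists q' => //; split => //; apply/andP; split => //.
    apply: lt_le_trans qq' _; rewrite ler_pM2l// lef_pV2 ?posrE//.
    by rewrite ler_nat.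
  apply/eqP; rewrite -measure_le0 -N0; apply: le_measure; rewrite ?inE//.
  (* A continuous path is uniformly small near the diagonal, so it leaves [M n] for some [n]: the
     intersection of the [M n] lies in [N]. *)
  move=> w Mw; apply: contrapT => /cF cFw.
  have [n _ /(_ n (leqnn n)) nP] :=
    near_diagonal_lt (-1) (t + 1) cFw (F0^~ w) e0.
  have [q _ [q' _ [/andP[qt qq']]]] := Mw n I.
  by rewrite ltNge ltW// nP.
apply: (@mu_ext_cvg0_le _ _ _ _ _ (fun n => N `|` M n)).
  apply: nearW => n w [u [v [ut uv eF]]].
  have [|/cF cFw] := pselect (N w); [by left|right].
  have h0 : 0 < n.+1%:R^-1 :> R by rewrite invr_gt0.
  have : \forall p \near (u, v), e < F p w.
    by apply: (cFw (u, v) [set y | e < y]); exact: lt_nbhsr.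
  move=> /nbhs_ballP[r /= r0 uvr].
  (* The three bounds keep the rational pair where [F] exceeds [e], its gap below [2 / (n + 1)], and
     its first point in [[-1, t + 1]]. *)
  pose r' := Num.min (r / 2) (Num.min (n.+1%:R^-1 / 2) 1).
  have r'0 : 0 < r' by rewrite !lt_min !divr_gt0//=.
  have dense_ball (x : R) : exists q : rat, `|x - ratr q| < r'.
    have [y [xy [q _ qy]]] := @dense_rat R (ball x r') (ex_intro _ x (ballxx x r'0))
      (ball_open x r').
    by exists q; move: xy; rewrite qy -ball_normE.
  have [[q uq] [q' vq']] := (dense_ball u, dense_ball v).
  move: uq vq'; rewrite !lt_min => /and3P[uq1 uq2 uq3] /and3P[vq1 vq2 vq3].
  exists q => //; exists q' => //; split.
    apply/andP; split.
      move: ut; rewrite !in_itv/= => /andP[u0 ut].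
      by move: uq3; rewrite ltr_norml => /andP[? ?]; apply/andP; split; lra.
    have -> : ratr q - ratr q' = - (u - ratr q) + (u - v) + (v - ratr q') by ring.
    apply: le_lt_trans (ler_normD _ _) _.
    have := ler_normD (- (u - ratr q)) (u - v); rewrite normrN.
    move: uv uq2 vq2; move: (_^-1) => h; lra.
  by apply: uvr; split; rewrite /= -ball_normE /=; lra.
apply: mu_extU_cvg0; last by under eq_fun do rewrite measurable_mu_extE//.
rewrite (_ : mu_ext P N = 0%E) ?measurable_mu_extE//; exact: cvg_cst.
Qed.

(** * Simple predictable approximations of [1 / W] *)

Section simple_sum.
Variables (R : realType) (tau : nat -> R) (c : nat -> R[i]).
Hypothesis tau_nd : forall i, tau i <= tau i.+1.

Local Notation term s i := (if s \in `]tau i, tau i.+1] then c i else 0).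

Lemma step_sum_le0 (m : nat) (s : R) : s <= tau 0%N ->
  \sum_(i < m) term s i = 0.
Proof.
move=> s0; rewrite big1// => i _; rewrite ifF//.
apply/negbTE; rewrite in_itv/= negb_and -leNgt (le_trans s0)//.
by elim: (val i) => // k IHk; exact: le_trans (tau_nd k).
Qed.

(** The half-open intervals are disjoint and cover []tau 0, tau m]], so exactly one term
    survives. *)
Lemma step_sumE (m : nat) (s : R) : tau 0%N < s -> s <= tau m ->
  exists2 i, (i < m)%N & s \in `]tau i, tau i.+1] /\ \sum_(i < m) term s i = c i.
Proof.
move=> s0; elim: m => [|m IHm] sm; first by rewrite ltNge sm in s0.
have [{}sm|ms] := leP s (tau m).
  have [i im [si sumE]] := IHm sm; exists i; first exact: ltnW.
  split => //; rewrite big_ord_recr/= sumE ifF ?addr0//.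
  by rewrite in_itv/= ltNge sm.
exists m => //; have smm : s \in `]tau m, tau m.+1] by rewrite in_itv/= ms.
split => //; rewrite big_ord_recr/= smm big1 ?add0r// => i _.
rewrite ifF//; apply/negbTE; rewrite in_itv/= negb_and -ltNge; apply/orP; right.
apply: le_lt_trans ms; move: (ltn_ord i); move: (val i) => k.
elim: m {IHm sm smm i} => // m IHm; rewrite ltnS leq_eqVlt => /predU1P[->//|km].
exact: le_trans (IHm km) _.
Qed.

End simple_sum.

Section inverse_grid.
Context {R : realType} {d : measure_display} {T : measurableType d}.
Variable P : probability T R.
Variables (W : R -> T -> R[i]) (a : R -> R).

Definition mesh (n i : nat) : R := i%:R / n.+1%:R.

(* The clock [a] is the positive part for Z and [alpha] for B, so that the two
   grids correspond to each other under the time change. *)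
Definition inverse_grid (n : nat) : @simple_process R d T :=
  SimpleProcess (n.+1 * n.+1)%N (fun i => a (mesh n i))
    (fun w => (W 0 w)^-1) (fun i w => (W (a (mesh n i)) w)^-1).

Lemma mesh_ge0 n i : 0 <= mesh n i.
Proof. by rewrite divr_ge0. Qed.

Lemma mesh_nd n i : mesh n i <= mesh n i.+1.
Proof. by rewrite ler_pM2r ?invr_gt0// ler_nat. Qed.

Lemma meshS n i : mesh n i.+1 = mesh n i + n.+1%:R^-1.
Proof. by rewrite /mesh -natr1 mulrDl mul1r. Qed.

(** With [(n + 1)^2] steps of length [1 / (n + 1)], the mesh is refined while its last point tends
    to infinity, so every compact time interval is eventually covered. *)
Lemma mesh_last n : mesh n (n.+1 * n.+1) = n.+1%:R.
Proof. by rewrite /mesh natrM mulfK. Qed.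

(** The sigma-algebra of the filtration at [u] is taken as a measurable space in its own right, so
    that the measurability of inverses applies to it. *)
Lemma sigma_measurableV u : 0 <= u ->
  sigma_measurable (natural_filtration W u) (fun w => (W u w)^-1).
Proof.
move=> u0; pose G := generated_by `[0, u] (ReP W) `|` generated_by `[0, u] (ImP W).
have uu : [set` `[0, u]] u by rewrite /= in_itv/= u0 lexx.
have mW : @cmeasurable R _ (g_sigma_algebraType G) (W u).
  split=> _ A mA; rewrite setTI; apply: sub_sigma_algebra; [left|right];
    by apply: sub_sigma_algebra; exists u => //; exists A => //; rewrite setTI.
have [mR mI] := cmeasurableV mW.
move=> A mA; split.
- by have := mR measurableT A mA; rewrite setTI.
- by have := mI measurableT A mA; rewrite setTI.
Qed.

Hypotheses (a0 : a 0 = 0) (a_ge0 : forall u, 0 <= a u).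
Hypothesis a_nd : {homo a : x y / x <= y}.

Lemma inverse_grid_predictable n :
  simple_predictable (natural_filtration W) (inverse_grid n).
Proof.
split => /=.
- exact: a_ge0.
- by move=> i; apply: a_nd; exact: mesh_nd.
- exact: sigma_measurableV.
- by move=> i _; exact: sigma_measurableV.
Qed.

Hypothesis a_continuous : continuous a.
Hypothesis a_surj : forall s, 0 <= s -> exists2 u, 0 <= u & a u = s.
Hypotheses (W_continuous : continuous_process P W)
  (W_neq0 : \forall w \ae P, forall t, 0 <= t -> W t w != 0).

(** [U] and [h] are quantified inside the almost sure event, so one null set serves for all
    compositions. *)
Lemma continuous_process_comp : \forall w \ae P,
  forall (U : topologicalType) (h : U -> R),
    continuous h -> (forall u, 0 <= h u) -> ccontinuous (fun u => W (h u) w).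
Proof.
case: W_continuous => _ _ cR cI; apply: filterS2 cR cI => w cRw cIw U h ch h0.
have Dh u : [set` `[0, +oo[] (h u) by rewrite /= in_itv/= h0.
by split; [exact: (continuous_comp_within cRw ch Dh)
          |exact: (continuous_comp_within cIw ch Dh)].
Qed.

Lemma cmeasurable_process t : 0 <= t -> cmeasurable (W t).
Proof. by case: W_continuous => mR mI _ _ t0; split; [exact: mR|exact: mI]. Qed.

Lemma ccontinuous_time_change : \forall w \ae P,
  forall (U : topologicalType) (h : U -> R), continuous h ->
    ccontinuous (fun u => W (a (h u)) w) /\
    ccontinuous (fun u => (W (a (h u)) w)^-1).
Proof.
apply: filterS2 W_neq0 continuous_process_comp => w W0 cW U h ch.
suff cWa : ccontinuous (fun u => W (a (h u)) w).
  by split => //; apply: ccontinuousV => // u; exact: W0.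
apply: (cW _ (fun u => a (h u))) => // u.
by apply: (@continuous_comp _ _ _ h a); [exact: ch|exact: a_continuous].
Qed.

(** On the diagonal the ratio is real, so its imaginary part vanishes there and must be small
    nearby. *)
Lemma ratio_cvg0 (t e : R) : 0 < e ->
  mu_ext P [set w | exists u v, [/\ u \in `[0, t], `|u - v| <= n.+1%:R^-1 &
    e < `|complex.Im (W (a v) w / W (a u) w)| ] ] @[n --> \oo] --> 0%E.
Proof.
move=> e0.
apply: (near_diagonal_cvg0 (F := fun p w =>
  `|complex.Im (W (a p.2) w / W (a p.1) w)|)) => //= [p||u w].
- have [_ mI] := cmeasurableM (cmeasurable_process (a_ge0 p.2))
    (cmeasurableV (cmeasurable_process (a_ge0 p.1))).
  exact: measurableT_comp.
- apply: filterS ccontinuous_time_change => w cW p; apply: cvg_norm.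
  have [cW2 _] := cW _ (@snd R R) (fun=> cvg_snd).
  have [_ cV1] := cW _ (@fst R R) (fun=> cvg_fst).
  by have [_] := ccontinuousM cW2 cV1; exact.
(* The diagonal condition is required at every [w]; where the path vanishes, the convention
   [0^-1 = 0] settles it. *)
- have [->|W0] := eqVneq (W (a u) w) 0; first by rewrite mul0r normr0.
  by rewrite mulfV// normr0.
Qed.

(** At time [s = a u] the step process equals [1 / W] at the preceding grid point, so the error is
    an increment of [1 / W] along the clock over a gap of at most [1 / (n + 1)]. *)
Lemma inverse_grid_cvg :
  ucp_cvg P (fun n => sp_val (inverse_grid n)) (fun t w => (W t w)^-1).
Proof.
move=> t e t0 e0; have [u0 u00 au0] := a_surj t0.
pose D (p : R * R) w := (W (a p.1) w)^-1 - (W (a p.2) w)^-1.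
pose F (p : R * R) w := `|complex.Re (D p w)| + `|complex.Im (D p w)|.
have mD p : cmeasurable (D p).
  by apply: cmeasurableB; apply: cmeasurableV; exact: cmeasurable_process.
have cF : \forall w \ae P, continuous (F^~ w).
  apply: filterS ccontinuous_time_change => w cW.
  have [cDR cDI] : ccontinuous (D^~ w).
    apply: ccontinuousB.
      by have [] := cW _ (@fst R R) (fun=> cvg_fst).
    by have [] := cW _ (@snd R R) (fun=> cvg_snd).
  by move=> p; apply: cvgD; apply: cvg_norm; [exact: cDR|exact: cDI].
have mF p : measurable_fun setT (F p).
  have [mDR mDI] := mD p.
  by apply: measurable_funD; exact: measurableT_comp.
have F0 u w : F (u, u) w = 0 by rewrite /F /D subrr /= normr0 addr0.
apply: mu_ext_cvg0_le (near_diagonal_cvg0 u0 mF cF F0 e0).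
have [N _ Nu0] := nbhs_infty_ger u0.
exists N => // n Nn w [s]; rewrite in_itv/= => /andP[s0 st] es.
have nd i : a (mesh n i) <= a (mesh n i.+1) by apply: a_nd; exact: mesh_nd.
have m0 : a (mesh n 0) = 0 by rewrite /mesh mul0r.
(* The step intervals are open on the left and miss 0; the coefficient at time 0 supplies the exact
   value there. *)
have [s_eq0|s_neq0] := eqVneq s 0.
  move: es; rewrite s_eq0 /sp_val eqxx /=.
  rewrite (step_sum_le0 (fun i => (W (a (mesh n i)) w)^-1) nd) ?m0//.
  by rewrite addr0 subrr Normc.normc0 ltNge ltW.
have [u ut us] : exists2 u, 0 <= u <= u0 & a u = s.
  have [u u_ge0 us] := a_surj s0; exists (Num.min u u0).
    by rewrite le_min u_ge0 u00 ge_min lexx orbT.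
  have [//|u0u] := leP u u0.
  by apply/eqP; rewrite eq_le au0 st -us -au0 a_nd// ltW.
move/andP: ut => [u_ge0 uu0].
have smax : s <= a (mesh n (n.+1 * n.+1)).
  rewrite mesh_last (le_trans st)// -au0 a_nd//.
  rewrite (le_trans (Nu0 n Nn))// ler_nat; exact: leqnSn.
have smin : a (mesh n 0) < s by rewrite m0 lt_neqAle eq_sym s_neq0.
have [i im [si sumE]] := step_sumE (fun i => (W (a (mesh n i)) w)^-1) nd smin smax.
move: es; rewrite /sp_val (negbTE s_neq0) add0r /= sumE => es.
move: si; rewrite in_itv/= => /andP[is_ si].
have mu : mesh n i < u.
  by rewrite ltNge; apply/negP => /a_nd; rewrite us leNgt is_.
(* The clock may be flat, so [u] could lie beyond the next mesh point; truncating it there leaves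
   its clock value equal to [s]. *)
exists (mesh n i), (Num.min u (mesh n i.+1)); split.
- by rewrite in_itv/= mesh_ge0 (le_trans (ltW mu)).
- rewrite distrC ger0_norm ?subr_ge0 ?le_min ?(ltW mu) ?mesh_nd//.
  by rewrite lerBlDl -meshS ge_min lexx orbT.
- apply: lt_le_trans es _.
  suff <- : a (Num.min u (mesh n i.+1)) = s by exact: normc_le_ReIm.
  have [//|mu'] := leP u (mesh n i.+1).
  by apply/eqP; rewrite eq_le si -us a_nd// ltW.
Qed.

Lemma sp_integral0 n w : sp_integral (inverse_grid n) W 0 w = 0.
Proof.
by rewrite /sp_integral big1// => i _ /=; rewrite !min_r ?a_ge0// subrr mulr0.
Qed.

Lemma stochastic_integral_grid (I : R -> T -> R[i]) :
  stochastic_integral P (natural_filtration W) (fun t w => (W t w)^-1) W I ->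
  ucp_cvg P (fun n => sp_integral (inverse_grid n) W) I.
Proof.
by apply; [exact: inverse_grid_predictable|exact: inverse_grid_cvg].
Qed.

End inverse_grid.

(** * The clocks *)

Section alpha.
Variables (R : realType) (lambda : R).
Hypothesis lambda_gt0 : 0 < lambda.

Lemma alpha_lt0 (t : R) : t < 0 -> alpha lambda t = 0.
Proof. by move=> t0; rewrite /alpha set_itv_ge ?Rintegral_set0// bnd_simp -ltNge. Qed.

(** For negative [t] the interval of integration is empty, so [alpha] factors through the positive
    part; the closed formula thus extends to a clock on the whole line. *)
Lemma alpha_max0 (t : R) : alpha lambda t = alpha lambda (Num.max 0 t).
Proof.
have [//|t0] := leP 0 t.
by rewrite alpha_lt0// alphaE// mulr0 expR0 subrr mul0r.
Qed.

Lemma alpha_maxE (t : R) :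
  alpha lambda t = (expR (2 * lambda * Num.max 0 t) - 1) / (2 * lambda).
Proof. by rewrite alpha_max0 alphaE// le_max lexx. Qed.

Lemma alpha0 : alpha lambda 0 = 0.
Proof. by rewrite alphaE// mulr0 expR0 subrr mul0r. Qed.

Lemma alpha_nd : {homo alpha lambda : x y / x <= y}.
Proof.
move=> x y xy; rewrite !alpha_maxE ler_pM2r ?invr_gt0 ?mulr_gt0//.
rewrite lerD2r ler_expR ler_pM2l ?mulr_gt0//.
by rewrite ge_max !le_max lexx xy orbT.
Qed.

Lemma alpha_ge0 t : 0 <= alpha lambda t.
Proof. by have [/alpha_lt0->//|/alpha_nd] := ltP t 0; rewrite alpha0. Qed.

Lemma alpha_continuous : continuous (alpha lambda).
Proof.
have cmax : continuous (fun t : R => 2 * lambda * Num.max 0 t).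
  move=> t; apply: cvgMr; apply: (@continuous_max R R^o (cst 0) id).
    exact: cvg_cst.
  exact: cvg_id.
have cexp : continuous (fun t : R => expR (2 * lambda * Num.max 0 t)).
  by move=> t; apply: continuous_comp; [exact: cmax|exact: continuous_expR].
rewrite (funext alpha_maxE) => t.
by apply: cvgMl; apply: cvgB; [exact: cexp|exact: cvg_cst].
Qed.

Lemma alphaK (s : R) : 0 <= s ->
  alpha lambda ((2 * lambda)^-1 * ln (1 + 2 * lambda * s)) = s.
Proof.
move=> s0; have l2 : 0 < 2 * lambda by rewrite mulr_gt0.
have s1 : 1 <= 1 + 2 * lambda * s by rewrite lerDl mulr_ge0// ltW.
rewrite alphaE//; last by rewrite mulr_ge0 ?invr_ge0 ?(ltW l2)// ln_ge0.
rewrite mulVKf ?gt_eqF// lnK ?posrE ?(lt_le_trans _ s1)//.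
by rewrite addrC addKr mulrC mulKf// gt_eqF.
Qed.

Lemma alphaVK (t : R) : 0 <= t ->
  (2 * lambda)^-1 * ln (1 + 2 * lambda * alpha lambda t) = t.
Proof.
move=> t0; have l2 : 2 * lambda != 0 by rewrite gt_eqF ?mulr_gt0.
by rewrite alphaE// mulrCA mulfV// mulr1 addrC subrK expRK mulKf.
Qed.

Lemma alpha_surj s : 0 <= s -> exists2 u, 0 <= u & alpha lambda u = s.
Proof.
move=> s0; exists ((2 * lambda)^-1 * ln (1 + 2 * lambda * s)); last exact: alphaK.
rewrite mulr_ge0 ?invr_ge0 ?mulr_ge0 ?(ltW lambda_gt0)// ln_ge0//.
by rewrite lerDl !mulr_ge0// ltW.
Qed.

End alpha.

Section positive_part_clock.
Variable R : realType.
Local Notation pos := (fun u : R => Num.max 0 u).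

Lemma pos0 : pos 0 = 0. Proof. exact: maxxx. Qed.

Lemma pos_ge0 u : 0 <= pos u. Proof. by rewrite /= le_max lexx. Qed.

Lemma pos_nd : {homo pos : x y / x <= y}.
Proof. by move=> x y xy; rewrite /= ge_max !le_max lexx xy orbT. Qed.

Lemma pos_continuous : continuous pos.
Proof.
move=> t; apply: (@continuous_max R R^o (cst 0) id); first exact: cvg_cst.
exact: cvg_id.
Qed.

Lemma pos_surj s : 0 <= s -> exists2 u, 0 <= u & pos u = s.
Proof. by move=> s0; exists s => //; exact: max_r. Qed.

End positive_part_clock.

(** * Comparison of the windings *)

Section grid_comparison.
Variables (R : realType) (lambda : R) (z b : R -> R[i]).
Hypotheses (lambda_gt0 : 0 < lambda) (b_neq0 : forall u, 0 <= u -> b u != 0).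
Hypothesis z_b : forall u, 0 <= u -> z u = (expR (- lambda * u))%:C * b u.

(* Both increments are ratios minus 1; the imaginary part discards the 1. *)
Lemma Im_increment_comparison (u v : R) : 0 <= u -> u <= v ->
  `|complex.Im ((z u)^-1 * (z v - z u)) - complex.Im ((b u)^-1 * (b v - b u))|
    <= lambda * (v - u) * `|complex.Im (b v / b u)|.
Proof.
move=> u0 uv; have v0 := le_trans u0 uv.
have E0 (x : R) : (expR x)%:C != 0 :> R[i].
  by rewrite eq_complex /= negb_and gt_eqF// expR_gt0.
have zE : (z u)^-1 * (z v - z u) = (expR (- lambda * (v - u)))%:C * (b v / b u) - 1.
  have -> : z v = (expR (- lambda * (v - u)))%:C * (expR (- lambda * u))%:C * b v.
    by rewrite z_b// -rmorphM -expRD -mulrDr subrK.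
  by rewrite z_b//; field; rewrite E0 b_neq0.
have bE : (b u)^-1 * (b v - b u) = b v / b u - 1.
  by rewrite mulrBr mulVf ?b_neq0// mulrC.
rewrite zE bE !ImB ImZ opprB addrA subrK -[X in _ - X]mul1r -mulrBl normrM ler_wpM2r//.
(* With [h = v - u], the bounds [1 - lambda h <= e^{- lambda h} <= 1] control the factor
   [e^{- lambda h} - 1]. *)
have := expR_ge1Dx (- lambda * (v - u)).
have : expR (- lambda * (v - u)) <= 1.
  by rewrite expR_le1 mulNr oppr_le0 mulr_ge0 ?subr_ge0// ltW.
by move=> ? ?; rewrite ler0_norm ?subr_le0//; lra.
Qed.

(** The bounds on single increments are proportional to the truncated steps [g (i + 1) - g i], which
    telescope to [g m <= s]. *)
Lemma Im_grid_comparison (n m : nat) (s e : R) : 0 <= s -> 0 <= e ->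
  (forall u v, u \in `[0, s] -> `|u - v| <= n.+1%:R^-1 ->
    `|complex.Im (b v / b u)| <= e) ->
  `|complex.Im (\sum_(i < m) (z (mesh n i))^-1 *
        (z (Num.min (mesh n i.+1) s) - z (Num.min (mesh n i) s))) -
    complex.Im (\sum_(i < m) (b (mesh n i))^-1 *
        (b (Num.min (mesh n i.+1) s) - b (Num.min (mesh n i) s)))|
    <= lambda * s * e.
Proof.
move=> s0 e0 be; pose g i := Num.min (mesh n i) s.
apply: (@le_trans _ _ (lambda * g m * e)); last first.
  by rewrite ler_wpM2r// ler_pM2l// ge_min lexx orbT.
elim: m => [|m IHm].
  rewrite !big_ord0 subrr normr0 !mulr_ge0 ?(ltW lambda_gt0)//.
  by rewrite le_min mesh_ge0.
rewrite !big_ord_recr /= !ImD opprD addrACA.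
apply: (le_trans (ler_normD _ _)).
have -> : lambda * g m.+1 * e = lambda * g m * e + lambda * (g m.+1 - g m) * e.
  by ring.
(* Once the mesh has passed [s], truncation makes both increments zero. *)
apply: (lerD IHm); have [sm|ms] := leP s (mesh n m).
  rewrite /g !min_r//; last by rewrite (le_trans sm)// mesh_nd.
  by rewrite !subrr !mulr0 subrr normr0 mul0r.
rewrite -/(g m.+1) /g [Num.min (mesh n m) s]min_l ?(ltW ms)//.
have mg : mesh n m <= Num.min (mesh n m.+1) s by rewrite le_min mesh_nd ltW.
apply: (le_trans (Im_increment_comparison (mesh_ge0 _ _) mg)).
apply: ler_wpM2l.
  by rewrite mulr_ge0 ?(ltW lambda_gt0)// subr_ge0.
apply: be; first by rewrite in_itv/= mesh_ge0 ltW.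
rewrite distrC ger0_norm ?subr_ge0//.
by rewrite lerBlDl -meshS ge_min lexx.
Qed.

End grid_comparison.

(** * Almost sure equality from vanishing outer probabilities *)

Section null_events.
Context {R : realType} {d : measure_display} {T : measurableType d}.
Variable P : probability T R.

Lemma negligible_cvg0 (A : set T) (B : nat -> set T) :
  (\forall n \near \oo, A `<=` B n) -> mu_ext P (B n) @[n --> \oo] --> 0%E ->
  P.-negligible A.
Proof.
move=> AB B0; apply/mu_ext_negligible.
have A0 := mu_ext_cvg0_le (A := fun=> A) AB B0.
by apply: (cvg_unique (@ereal_hausdorff R) _ A0); exact: cvg_cst.
Qed.

(** Two paths that differ at some time differ by more than some [1 / (k + 1)] before some integer
    time [N], which makes the exceptional event a countable union. *)
Lemma ae_eq_ge0 (x y : R -> T -> R) :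
  (forall N k : nat, P.-negligible [set w | exists2 s, s \in `[0, N%:R] &
      k.+1%:R^-1 < `|x s w - y s w|]) ->
  \forall w \ae P, forall s, 0 <= s -> x s w = y s w.
Proof.
move=> xy; have /negligible_bigcup N1 : forall N, P.-negligible (\bigcup_k
    [set w | exists2 s, s \in `[0, N%:R] & k.+1%:R^-1 < `|x s w - y s w|]).
  by move=> N; exact: negligible_bigcup.
apply: negligibleS N1 => w /= /existsNP[s /not_implyP[s0 /eqP xys]].
have d0 : 0 < `|x s w - y s w| by rewrite normr_gt0 subr_eq0.
have [k _ /(_ k (leqnn k)) kd] := near_infty_natSinv_lt (PosNum d0).
exists (Num.bound s) => //; exists k => //; exists s => //.
by rewrite in_itv/= s0 (ltW (archi_boundP s0)).
Qed.

End null_events.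

Section winding.
Context {R : realType} {d : measure_display} {T : measurableType d}.
Variable P : probability T R.

(** The elementary integrals all vanish at time 0, hence so does their limit. The exit time of the
    winding from []-c, c[] needs this starting point. *)
Lemma winding_start (W : R -> T -> R[i]) (theta : R -> T -> R) :
  winding_process P W theta -> \forall w \ae P, theta 0 w = 0.
Proof.
move=> [cW W0 _ [I WI thI]].
have IZ := stochastic_integral_grid (@pos0 R) (@pos_ge0 R) (@pos_nd R)
  (@pos_continuous R) (@pos_surj R) cW W0 WI.
(* The time [s] is a dummy that gives the claim the form of [ae_eq_ge0]. *)
suff : \forall w \ae P, forall s : R, 0 <= s -> complex.Im (I 0 w) = 0.
  by move=> I0; apply: filterS2 thI I0 => w thI /(_ 0 (lexx _)); rewrite thI.
apply: (@ae_eq_ge0 _ _ _ P (fun=> fun w => complex.Im (I 0 w)) (fun=> cst 0)) => N k.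
have k0 : 0 < k.+1%:R^-1 :> R by rewrite invr_gt0.
apply: negligible_cvg0 (IZ 0 k.+1%:R^-1 (lexx _) k0).
apply: nearW => n w /= [s _]; rewrite subr0 => kI.
exists 0; first by rewrite in_itv/= lexx.
apply: (lt_le_trans kI).
rewrite sp_integral0; last exact: pos_ge0.
by apply: le_trans (normIm_le_normc _); rewrite ImB /= sub0r normrN.
Qed.

Variables (lambda : R) (Z B : R -> T -> R[i]).
Hypothesis lambda_gt0 : 0 < lambda.
Hypothesis Z_B : \forall w \ae P, forall t, 0 <= t ->
  Z t w = (expR (- lambda * t))%:C * B (alpha lambda t) w.

Lemma winding_time_change (thetaZ thetaB : R -> T -> R) :
  winding_process P Z thetaZ -> winding_process P B thetaB ->
  \forall w \ae P, forall t, 0 <= t -> thetaZ t w = thetaB (alpha lambda t) w.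
Proof.
move=> [cZ Z0 _ [IZ ZI thZ]] [cB B0 _ [IB BI thB]].
have gZ := stochastic_integral_grid (@pos0 R) (@pos_ge0 R) (@pos_nd R)
  (@pos_continuous R) (@pos_surj R) cZ Z0 ZI.
have gB := stochastic_integral_grid (alpha0 lambda_gt0) (alpha_ge0 lambda_gt0)
  (alpha_nd lambda_gt0) (alpha_continuous lambda_gt0) (alpha_surj lambda_gt0)
  cB B0 BI.
suff IE : \forall w \ae P, forall s, 0 <= s ->
    complex.Im (IZ s w) = complex.Im (IB (alpha lambda s) w).
  apply: filterS3 thZ thB IE => w thZ thB IE t t0.
  by rewrite thZ// thB ?alpha_ge0// IE.
apply: ae_eq_ge0 => N k; set e : R := k.+1%:R^-1.
have e0 : 0 < e by rewrite invr_gt0.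
have e3 : 0 < e / 3 by rewrite divr_gt0.
(* Chosen so that [lambda * s * e' <= e / 3] for [s <= N]; the added 1 keeps the denominator
   positive when [N = 0]. *)
pose e' := e / 3 / (lambda * N%:R + 1).
have lN : 0 <= lambda * N%:R by rewrite mulr_ge0// ltW.
have lN1 : 0 < lambda * N%:R + 1 by rewrite ltr_wpDl.
have e'0 : 0 < e' by rewrite divr_gt0.
have [Nb [mNb PNb badNb]] : P.-negligible (~` [set w |
    (forall t, 0 <= t -> B t w != 0) /\ (forall t, 0 <= t ->
      Z t w = (expR (- lambda * t))%:C * B (alpha lambda t) w)]).
  by apply: filterS2 B0 Z_B.
have Nb0 : mu_ext P Nb @[_ --> \oo] --> 0%E.
  rewrite (_ : mu_ext P Nb = 0%E); first exact: cvg_cst.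
  by apply/mu_ext_negligible; exists Nb; split.
have ratio := ratio_cvg0 (alpha_ge0 lambda_gt0) (alpha_continuous lambda_gt0)
  cB B0 N%:R e'0.
have gZ' := gZ N%:R (e / 3) (ler0n _ _) e3.
have gB' := gB (alpha lambda N%:R) (e / 3) (alpha_ge0 lambda_gt0 _) e3.
(* Outside these four events, three errors of at most [e / 3] add up: each grid sum against its
   integral, and the two sums against each other. *)
apply: negligible_cvg0 (mu_extU_cvg0 (mu_extU_cvg0 gZ' gB') (mu_extU_cvg0 Nb0 ratio)).
apply: nearW => n w /= [s]; rewrite in_itv/= => /andP[s0 sN] es.
apply: contrapT => /not_orP[/not_orP[nZ nB] /not_orP[nNb nr]].
have [B0w Z_Bw] : (forall t, 0 <= t -> B t w != 0) /\ (forall t, 0 <= t ->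
      Z t w = (expR (- lambda * t))%:C * B (alpha lambda t) w).
  by apply: contrapT => bad; apply: nNb; exact: badNb.
have {}nZ : `|complex.Im (sp_integral (inverse_grid Z (Num.max 0) n) Z s w)
    - complex.Im (IZ s w)| <= e / 3.
  rewrite -ImB; apply: (le_trans (normIm_le_normc _)).
  by rewrite leNgt; apply/negP => h; apply: nZ; exists s; rewrite ?in_itv/= ?s0.
have {}nB : `|complex.Im (sp_integral (inverse_grid B (alpha lambda) n) B
    (alpha lambda s) w) - complex.Im (IB (alpha lambda s) w)| <= e / 3.
  rewrite -ImB; apply: (le_trans (normIm_le_normc _)).
  rewrite leNgt; apply/negP => h; apply: nB; exists (alpha lambda s) => //.
  by rewrite in_itv/= alpha_ge0 // alpha_nd.
have nZB : `|complex.Im (sp_integral (inverse_grid Z (Num.max 0) n) Z s w) -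
    complex.Im (sp_integral (inverse_grid B (alpha lambda) n) B
    (alpha lambda s) w)| <= e / 3.
  (* Being nondecreasing, [alpha] commutes with truncation, so the sum for [B] stopped at [alpha s]
     is the sum for [B] composed with [alpha], stopped at [s]. *)
  have min_alpha u v : Num.min (alpha lambda u) (alpha lambda v) =
      alpha lambda (Num.min u v).
    by have [uv|/ltW vu] := leP u v; [rewrite min_l|rewrite min_r]; rewrite ?alpha_nd.
  have le_e' : lambda * s * e' <= e / 3.
    rewrite /e' mulrCA ler_piMr ?ltW// ltr_pdivrMr// mul1r.
    by rewrite ltr_pwDr// ler_pM2l.
  apply: le_trans le_e'.
  apply: etrans (@Im_grid_comparison _ lambda (Z^~ w) (fun u => B (alpha lambda u) w)
    lambda_gt0 (fun u u0 => B0w _ (alpha_ge0 lambda_gt0 u)) Z_Bw n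
    (n.+1 * n.+1)%N s e' s0 (ltW e'0) _).
    congr (`|complex.Im _ - complex.Im _| <= _); apply: eq_bigr => i _ /=.
      by rewrite !max_r ?mesh_ge0.
    by rewrite !min_alpha.
  move=> u v us uv; rewrite leNgt; apply/negP => h; apply: nr.
  exists u, v; split => //.
  by move: us; rewrite !in_itv/= => /andP[-> /le_trans]; apply.
move: nZ nB nZB es; rewrite -/e !ler_norml.
move=> /andP[? ?] /andP[? ?] /andP[? ?]; apply/negP; rewrite -leNgt ler_norml.
by apply/andP; split; lra.
Qed.

End winding.

(** * Hitting times *)

Section hitting_times.
Variable R : realType.
Implicit Types (x y : R -> R) (c t : R).

Lemma hitting_time_ge0 x c : (0 <= hitting_time x c)%E.
Proof. by apply: le_ereal_inf_tmp => _ [t [t0 _] <-]; rewrite lee_fin. Qed.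

(** By the intermediate value theorem, a path starting at 0 that lies outside []-c, c[] at time [t]
    has reached modulus exactly [c] by then. *)
Lemma exit_hitting_time y c : 0 < c -> y 0 = 0 ->
  {within `[0, +oo[, continuous y} -> exit_time y c = hitting_time y c.
Proof.
move=> c0 y0 cy; apply/eqP; rewrite eq_le; apply/andP; split.
  apply: le_ereal_inf_tmp => _ [t [t0 yt] <-]; apply: ereal_inf_lbound.
  by exists t => //; split => //; rewrite in_itv/= -ltr_norml yt ltxx.
apply: le_ereal_inf_tmp => _ [t [t0 yt] <-].
have cy0t : {within `[0, t], continuous (fun s => `|y s|)}.
  have sub : `[0, t] `<=` `[0, +oo[ by move=> s /=; rewrite !in_itv/= => /andP[->].
  have /subspace_continuousP cyt := continuous_subspaceW sub cy.
  by apply/subspace_continuousP => s /cyt ys; exact: cvg_norm.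
have ct : c <= `|y t| by move: yt; rewrite in_itv/= -ltr_norml -leNgt.
have [|s /[!in_itv]/= /andP[s0 st] ys] := IVT t0 cy0t (v := c).
  by rewrite y0 normr0 minEle maxEle normr_ge0 (ltW c0).
apply: (@le_trans _ _ s%:E); last by rewrite lee_fin.
by apply: ereal_inf_lbound; exists s.
Qed.

Variables (lambda : R).
Hypothesis lambda_gt0 : 0 < lambda.

(** [alpha] is an increasing bijection of the half-line with inverse [psi], so it matches the hits
    of [x] with those of [y], and their infima correspond. *)
Lemma hitting_time_alpha x y c :
  (forall t, 0 <= t -> x t = y (alpha lambda t)) ->
  hitting_time x c =
    ((2 * lambda)^-1%:E * lne (1 + (2 * lambda)%:E * hitting_time y c))%E.
Proof.
move=> xy; have l2 : 0 < 2 * lambda by rewrite mulr_gt0.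
pose psi s := (2 * lambda)^-1 * ln (1 + 2 * lambda * s).
have pos1 s : 0 <= s -> 0 < 1 + 2 * lambda * s.
  by move=> s0; rewrite ltr_wpDr// mulr_ge0// ltW.
have psiE s : 0 <= s ->
    ((2 * lambda)^-1%:E * lne (1 + (2 * lambda)%:E * s%:E))%E = (psi s)%:E.
  by move=> s0; rewrite -EFinM -EFinD lne_EFin ?pos1// -EFinM.
have psi_nd s t : 0 <= s -> s <= t -> psi s <= psi t.
  move=> s0 st; have t0 := le_trans s0 st.
  by rewrite /psi ler_pM2l ?invr_gt0// ler_ln ?posrE ?pos1// lerD2l ler_pM2l.
have psi_ge0 s : 0 <= s -> 0 <= psi s.
  move=> s0; rewrite /psi mulr_ge0 ?invr_ge0 ?(ltW l2)// ln_ge0//.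
  by rewrite lerDl mulr_ge0// ltW.
have hit t : 0 <= t -> `|y t| = c -> (hitting_time x c <= (psi t)%:E)%E.
  move=> t0 yt; apply: ereal_inf_lbound; exists (psi t) => //.
  by split; [exact: psi_ge0|rewrite xy ?psi_ge0// alphaK].
have := hitting_time_ge0 y c; case yE : (hitting_time y c) => [r| |]// r0.
- rewrite lee_fin in r0; rewrite psiE//; apply/eqP; rewrite eq_le; apply/andP; split.
    rewrite leNgt; apply/negP => rx.
    (* The hitting time of [x] could be infinite, so a finite [q] is placed above [psi r] and no
       later than any hit of [x]; then [alpha q <= r], which contradicts [psi r < q]. *)
    have [q q0 /andP[rq qx]] : exists2 q, 0 <= q &
        (psi r < q) && (q%:E <= hitting_time x c)%E.
      case: (hitting_time x c) rx => [q| |]// rx.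
        rewrite lte_fin in rx; exists q; last by rewrite rx lexx.
        exact: le_trans (psi_ge0 _ r0) (ltW rx).
      exists (psi r + 1); first by rewrite addr_ge0 ?psi_ge0.
      by rewrite ltrDl ltr01 leey.
    have : ((alpha lambda q)%:E <= r%:E)%E.
      rewrite -yE; apply: le_ereal_inf_tmp => _ [t [t0 yt] <-].
      have := le_trans qx (hit t t0 yt); rewrite !lee_fin => /(alpha_nd lambda_gt0).
      by rewrite alphaK.
    rewrite lee_fin => /(psi_nd _ _ (alpha_ge0 lambda_gt0 q)).
    by rewrite /psi alphaVK// leNgt rq.
  apply: le_ereal_inf_tmp => _ [t [t0 xt] <-].
  have : (r%:E <= (alpha lambda t)%:E)%E.
    rewrite -yE; apply: ereal_inf_lbound; exists (alpha lambda t) => //.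
    by rewrite /= -xy//; split => //; exact: alpha_ge0.
  rewrite !lee_fin => /(psi_nd _ _ r0); rewrite {2}/psi alphaVK//.
(* If [y] never hits, the right side is [+oo], and a hit of [x] at [t] would give one of [y] at
   [alpha t]. *)
- rewrite gt0_muley ?lte_fin//= gt0_muley ?lte_fin ?invr_gt0//.
  apply/eqP; rewrite -leye_eq; apply: le_ereal_inf_tmp => _ [t [t0 xt] <-].
  have : (hitting_time y c <= (alpha lambda t)%:E)%E.
    apply: ereal_inf_lbound; exists (alpha lambda t) => //.
    by rewrite /= -xy//; split => //; exact: alpha_ge0.
  by rewrite yE leNgt ltry.
Qed.

End hitting_times.

Theorem proposition3p1 (R : realType) (d : measure_display)
    (T : measurableType d) (P : probability T R)
    (z0 : R[i]) (lambda : R) (Zt Z B : R -> T -> R[i])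
    (thetaZ thetaB : R -> T -> R)
    (z0_neq0 : z0 != 0) (lambda_gt0 : 0 < lambda)
    (Zt_bm : complex_brownian_motion P 0 Zt)
    (Z_ou : ornstein_uhlenbeck P z0 lambda Zt Z)
    (B_bm : complex_brownian_motion P z0 B)
    (Z_B : \forall w \ae P, forall t, 0 <= t ->
       Z t w = (expR (- lambda * t))%:C * B (alpha lambda t) w)
    (thetaZ_winding : winding_process P Z thetaZ)
    (thetaB_winding : winding_process P B thetaB) :
  \forall w \ae P,
    (forall t, 0 <= t -> thetaZ t w = thetaB (alpha lambda t) w) /\
    (forall c, 0 < c ->
       hitting_time (fun t => thetaZ t w) c =
       ((2 * lambda)^-1%:E *
        lne (1 + (2 * lambda)%:E * exit_time (fun t => thetaB t w) c))%E).
Proof.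
have thetaZB := winding_time_change lambda_gt0 Z_B thetaZ_winding thetaB_winding.
apply: filterS3 thetaZB (winding_start thetaB_winding) (wp_continuous thetaB_winding).
move=> w thZB thB0 cthB; split => // c c0.
by rewrite exit_hitting_time//; exact: hitting_time_alpha.
Qed.
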